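(* The following algorithm is a randomized $3/2$-approximation algorithm for multi-criteria ATSP(1,2), and its running time is polynomial: compute a Pareto curve of (directed) cycle covers of the input graph (possible with probability at least $1/2$ in polynomial time, since the objectives are polynomially bounded and multi-criteria directed cycle cover admits a fully polynomial-time randomized approximation scheme); then, for every cycle cover $C$ in this set, remove one edge from every cycle of $C$, join the resulting paths into a Hamiltonian cycle $S$, and output the set of all Hamiltonian cycles $S$ obtained this way.
   Context: Multi-criteria ATSP(1,2): an instance is a directed complete graph $G=(V,E)$ with a fixed number $k$ of edge weight functions $w_1,\dots,w_k: E \to \{1,2\}$; the weight of an edge set is the sum of its edge weights, and all $k$ objectives (weights of the Hamiltonian cycle) are to be minimized. A cycle cover is a spanning subgraph consisting solely of directed cycles such that every vertex lies on exactly one cycle (every cycle has length at least two). A set $\mathcal{P}^{\mathrm{apx}}(x)$ of feasible solutions is a $\beta$-approximate Pareto curve if for every feasible solution $z$ there is $y \in \mathcal{P}^{\mathrm{apx}}(x)$ with $w_i(y) \le \beta\, w_i(z)$ for all $i\in[k]$; a Pareto curve is a $1$-approximate Pareto curve. A randomized $\beta$-approximation algorithm is a polynomial-time algorithm that outputs a $\beta$-approximate Pareto curve with probability at least $1/2$. *)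

(* Defs.v *)
From mathcomp Require Import all_boot all_order all_algebra.
From mathcomp Require Import boolp.
From Corelib Require BinNums.

Set Implicit Arguments.
Unset Strict Implicit.
Unset Printing Implicit Defensive.

Import GRing.Theory Num.Theory.

(* Plain MathComp; only [boolp] is taken from MathComp-Analysis, for [`[< _ >]].

   Computation model: a probabilistic version of Jones' WHILE language.  Data
   are binary trees.  Evaluating an expression costs the total size of the
   values of all its subexpressions, so that values are charged as if they were
   copied; hence polynomial time here is polynomial time on (probabilistic)
   Turing machines. *)

Inductive tree : Type := Leaf | Node of tree & tree.

Fixpoint tsize (t : tree) : nat :=
  if t is Node a b then (tsize a + tsize b).+1 else 1%N.

Fixpoint tree_eqb (t u : tree) : bool :=
  match t, u with
  | Leaf, Leaf => true
  | Node a b, Node c d => tree_eqb a c && tree_eqb b d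
  | _, _ => false
  end.

Definition enc_bool (b : bool) : tree := if b then Node Leaf Leaf else Leaf.

Definition truth (t : tree) : bool := if t is Node _ _ then true else false.

Inductive expr : Type :=
  | EVar of nat
  | ELeaf
  | ENode of expr & expr
  | EHd of expr
  | ETl of expr
  | EEq of expr & expr.

Definition store := nat -> tree.

Fixpoint eval (s : store) (e : expr) : tree :=
  match e with
  | EVar x => s x
  | ELeaf => Leaf
  | ENode e1 e2 => Node (eval s e1) (eval s e2)
  | EHd e1 => if eval s e1 is Node a _ then a else Leaf
  | ETl e1 => if eval s e1 is Node _ b then b else Leaf
  | EEq e1 e2 => enc_bool (tree_eqb (eval s e1) (eval s e2))
  end.

Fixpoint ecost (s : store) (e : expr) : nat :=
  (tsize (eval s e) +
   match e with
   | EVar _ | ELeaf => 0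
   | ENode e1 e2 | EEq e1 e2 => ecost s e1 + ecost s e2
   | EHd e1 | ETl e1 => ecost s e1
   end)%N.

Inductive cmd : Type :=
  | Skip
  | Assign of nat & expr
  | Flip of nat
  | Seq of cmd & cmd
  | If of expr & cmd & cmd
  | While of expr & cmd.

Definition upd (s : store) (x : nat) (v : tree) : store :=
  fun y => if y == x then v else s y.

(* [exec r c s i t s' i'] : started in store s, with the first i coins of the
   stream r already used, c halts in store s' after t units of time, i' coins
   having been used by then. *)
Inductive exec (r : nat -> bool) :
    cmd -> store -> nat -> nat -> store -> nat -> Prop :=
  | exec_skip s i : exec r Skip s i 1 s i
  | exec_assign s i x e :
      exec r (Assign x e) s i (ecost s e).+1 (upd s x (eval s e)) i
  | exec_flip s i x : exec r (Flip x) s i 1 (upd s x (enc_bool (r i))) i.+1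
  | exec_seq c1 c2 s i t1 s1 i1 t2 s2 i2 :
      exec r c1 s i t1 s1 i1 -> exec r c2 s1 i1 t2 s2 i2 ->
      exec r (Seq c1 c2) s i (t1 + t2).+1 s2 i2
  | exec_if_true e c1 c2 s i t s' i' :
      truth (eval s e) -> exec r c1 s i t s' i' ->
      exec r (If e c1 c2) s i (ecost s e + t).+1 s' i'
  | exec_if_false e c1 c2 s i t s' i' :
      ~~ truth (eval s e) -> exec r c2 s i t s' i' ->
      exec r (If e c1 c2) s i (ecost s e + t).+1 s' i'
  | exec_while_false e c s i :
      ~~ truth (eval s e) -> exec r (While e c) s i (ecost s e).+1 s i
  | exec_while_true e c s i t1 s1 i1 t2 s2 i2 :
      truth (eval s e) -> exec r c s i t1 s1 i1 ->
      exec r (While e c) s1 i1 t2 s2 i2 ->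
      exec r (While e c) s i (ecost s e + t1 + t2).+1 s2 i2.

Definition init_store (v : tree) : store := fun x => if x is 0%N then v else Leaf.

(* Input and output are in variable 0. *)
Definition runs (c : cmd) (v : tree) (r : nat -> bool) (t : nat) (y : tree) :=
  exists s' i', exec r c (init_store v) 0%N t s' i' /\ s' 0%N = y.

Definition halts_within (c : cmd) (v : tree) (T : nat) : Prop :=
  forall r, exists t y, runs c v r t y /\ (t <= T)%N.

(* Probability over T independent fair coins.  A program that halts within time
   T uses at most T coins, so the padding with false is never read. *)
Definition prob (T : nat) (E : (nat -> bool) -> Prop) : rat :=
  (#|[set u : T.-tuple bool | `[< E (nth false u) >]]|%:R / 2 ^+ T)%R.

Section RandomizedAlgorithms.

Variables (X : Type) (dom : X -> Prop) (enc : X -> tree).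

Definition polytime (c : cmd) : Prop :=
  exists p : {poly nat}, forall x, dom x ->
    halts_within c (enc x) p.[tsize (enc x)]%R.

Definition randomized_algorithm (ok : X -> tree -> Prop) (c : cmd) : Prop :=
  exists p : {poly nat}, forall x, dom x ->
    let T := p.[tsize (enc x)]%R in
    halts_within c (enc x) T /\
    (1 / 2 <= prob T (fun r => exists t y, runs c (enc x) r t y /\ ok x y))%R.

End RandomizedAlgorithms.

(* Edges of the complete directed graph on 'I_n are the pairs (u, v) with
   u != v; values of weight functions on the diagonal are meaningless and are
   neither encoded nor ever used. *)
Record inst (k : nat) : Type := Inst {
  nv : nat;
  nv_gt1 : (1 < nv)%N;
  wt : 'I_k -> 'I_nv -> 'I_nv -> nat }.

Definition weights12 (k : nat) (x : inst k) : Prop :=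
  forall (i : 'I_k) (u v : 'I_(nv x)), u != v -> wt i u v \in [:: 1%N; 2%N].

Definition positive_weights (k : nat) (x : inst k) : Prop :=
  forall (i : 'I_k) (u v : 'I_(nv x)), u != v -> (0 < wt i u v)%N.

Section Encodings.

Definition enc_seq (A : Type) (f : A -> tree) (s : seq A) : tree :=
  foldr (fun a t => Node (f a) t) Leaf s.

Definition enc_unary (m : nat) : tree := iter m (Node Leaf) Leaf.

Fixpoint bits_pos (p : BinNums.positive) : seq bool :=
  match p with
  | BinNums.xH => [:: true]
  | BinNums.xO q => false :: bits_pos q
  | BinNums.xI q => true :: bits_pos q
  end.

Definition bits (m : nat) : seq bool :=
  if bin_of_nat m is BinNums.Npos p then bits_pos p else [::].

Definition enc_binary (m : nat) : tree := enc_seq enc_bool (bits m).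

Definition enc_inst (k : nat) (x : inst k) : tree :=
  Node (enc_unary (nv x))
    (enc_seq (fun i : 'I_k =>
       enc_seq (fun u : 'I_(nv x) =>
         enc_seq (fun v : 'I_(nv x) =>
           enc_binary (if u == v then 0%N else wt i u v))
         (enum 'I_(nv x)))
       (enum 'I_(nv x)))
     (enum 'I_k)).

Definition enc_edge (n : nat) (e : 'I_n * 'I_n) : tree :=
  Node (enc_unary e.1) (enc_unary e.2).

(* t lists the members of P in some order, possibly with repetitions; each
   member is given by the list of its edges, in some order and without
   repetitions. *)
Definition lists (n : nat) (t : tree) (P : {set {set 'I_n * 'I_n}}) : Prop :=
  exists ls : seq (seq ('I_n * 'I_n)),
    [/\ t = enc_seq (enc_seq (@enc_edge n)) ls,
        all uniq ls
      & P = [set S in [seq [set:: l] | l <- ls]]].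

End Encodings.

Section Graphs.

Variable n : nat.
Implicit Types (c : seq 'I_n) (cs : seq (seq 'I_n)) (C D S : {set 'I_n * 'I_n}).

Definition cycle_edges c : {set 'I_n * 'I_n} :=
  [set e | (e.1 \in c) && (e.2 == next c e.1)].

Definition hamiltonian S : Prop :=
  exists c, [/\ (1 < size c)%N, perm_eq c (enum 'I_n) & S = cycle_edges c].

Definition cycles_of C cs : Prop :=
  [/\ all (fun c => 1 < size c)%N cs,
      perm_eq (flatten cs) (enum 'I_n)
    & C = \bigcup_(c <- cs) cycle_edges c].

Definition cycle_cover C : Prop := exists cs, cycles_of C cs.

(* D is the set of removed edges, one from each cycle of C. *)
Definition patched C S : Prop :=
  exists cs D,
    [/\ cycles_of C cs,
        D \subset C,
        forall c, c \in cs -> #|D :&: cycle_edges c| = 1%N,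
        hamiltonian S
      & C :\: D \subset S].

Definition patched_family (P Q : {set {set 'I_n * 'I_n}}) : Prop :=
  (forall C, C \in P -> exists2 S, S \in Q & patched C S) /\
  (forall S, S \in Q -> exists2 C, C \in P & patched C S).

End Graphs.

Definition weight (k : nat) (x : inst k) (i : 'I_k)
    (S : {set 'I_(nv x) * 'I_(nv x)}) : nat :=
  (\sum_(e in S) wt i e.1 e.2)%N.

Definition approx_pareto (k : nat) (x : inst k)
    (feasible : {set 'I_(nv x) * 'I_(nv x)} -> Prop) (beta : rat)
    (P : {set {set 'I_(nv x) * 'I_(nv x)}}) : Prop :=
  (forall y, y \in P -> feasible y) /\
  (forall z, feasible z -> exists2 y, y \in P &
     forall i : 'I_k, ((weight i y)%:R <= beta * (weight i z)%:R)%R).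

Definition outputs_pareto (k : nat)
    (feasible : forall n : nat, {set 'I_n * 'I_n} -> Prop) (beta : rat)
    (x : inst k) (t : tree) : Prop :=
  exists2 P, lists t P & approx_pareto (feasible (nv x)) beta P.

Definition polytime12 (k : nat) (c : cmd) : Prop :=
  polytime (@weights12 k) (@enc_inst k) c.

Definition atsp12_approximation (k : nat) (beta : rat) (c : cmd) : Prop :=
  randomized_algorithm (@weights12 k) (@enc_inst k)
    (outputs_pareto hamiltonian beta) c.

Definition cycle_cover_pareto12 (k : nat) (c : cmd) : Prop :=
  randomized_algorithm (@weights12 k) (@enc_inst k)
    (outputs_pareto cycle_cover 1%R) c.

(* FPRAS for k-criteria minimum-weight directed cycle cover with arbitrary
   positive integer weights, written in binary.  The accuracy is
   epsilon = 1/m; m is written in unary, so that time polynomial in the size of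
   the encoded pair is time polynomial in the size of x and in 1/epsilon. *)
Definition cycle_cover_fpras (k : nat) (c : cmd) : Prop :=
  randomized_algorithm
    (fun xm : inst k * nat => positive_weights xm.1 /\ (0 < xm.2)%N)
    (fun xm => Node (enc_inst xm.1) (enc_unary xm.2))
    (fun xm => outputs_pareto cycle_cover (1 + xm.2%:R^-1)%R xm.1) c.

(* A is an implementation of the patching algorithm whose first step is B: on
   every coin stream, if B outputs a set P of cycle covers, then A outputs a
   set of Hamiltonian cycles obtained by patching the members of P. *)
Definition implements_patching (k : nat) (B A : cmd) : Prop :=
  forall (x : inst k) (r : nat -> bool) (t : nat) (y : tree)
         (P : {set {set 'I_(nv x) * 'I_(nv x)}}),
    weights12 x -> runs B (enc_inst x) r t y -> lists y P ->
    (forall C, C \in P -> cycle_cover C) ->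
    exists t' y' Q,
      [/\ runs A (enc_inst x) r t' y', lists y' Q & patched_family P Q].

(* Main.v *)
(** Removing one edge from each cycle of a cycle cover [C] removes at most n/2
    edges, since every cycle has at least two vertices, and each edge used to
    reconnect the paths costs at most 1 more than the edge it replaces. As the
    weight of [C] is at least n, the resulting Hamiltonian cycle weighs at most
    3/2 times as much as [C]. Hamiltonian cycles are cycle covers, so a Pareto
    curve of cycle covers dominates every Hamiltonian cycle.

    The weight of a cycle cover is at most 2n, so an approximation within
    1 + 1/(2n+1) is exact; the Pareto curve of cycle covers is therefore
    obtained from the approximation scheme with accuracy 1/(2n+1).

    To patch a cycle cover given as a list of edges in arbitrary order, walk
    along the edges, deleting each one used, and restart at an arbitrary
    remaining edge whenever no edge leaves the current vertex. This happens
    exactly when a cycle is completed, so the vertices are visited cycle by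
    cycle, and the Hamiltonian cycle through them in the order of visit
    contains all edges of the cover but the closing edge of each cycle. *)

From mathcomp Require Import all_boot all_order all_algebra.
From mathcomp Require Import boolp zify.
Require Import Defs.

Set Implicit Arguments.
Unset Strict Implicit.
Unset Printing Implicit Defensive.

Import Order.TTheory GRing.Theory Num.Theory.

Local Notation pval p n := (horner (p : {poly nat}) n : nat).

(** * Programs computing functions on trees *)

Lemma pvalD (p q : {poly nat}) (n : nat) :
  pval (p + q)%R n = (pval p n + pval q n)%N.
Proof. exact: hornerD. Qed.

Lemma pvalM (p q : {poly nat}) (n : nat) :
  pval (p * q)%R n = (pval p n * pval q n)%N.
Proof. exact: hornerM. Qed.

Definition cst (c : nat) : {poly nat} := polyC c.

Lemma pvalC (c n : nat) : pval (cst c) n = c.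
Proof. exact: hornerC. Qed.

Lemma pvalX (n : nat) : pval ('X)%R n = n.
Proof. exact: hornerX. Qed.

Lemma pval_comp (p q : {poly nat}) (n : nat) :
  pval (p \Po q)%R n = pval p (pval q n).
Proof. exact: horner_comp. Qed.

Definition pvalE := (pvalD, pvalM, pvalC, pvalX, pval_comp).

Lemma leq_pval (p : {poly nat}) (m n : nat) : m <= n -> pval p m <= pval p n.
Proof.
move=> le_mn; rewrite /horner; elim: (polyseq p) => //= a s IHs.
by apply: leq_add => //; apply: leq_mul.
Qed.

Lemma tsize_gt0 t : 0 < tsize t.
Proof. by case: t. Qed.

Lemma tsize_eval_le s e : tsize (eval s e) <= ecost s e.
Proof. by case: e => *; apply: leq_addr. Qed.

(** Such expressions depend on variable 0 alone, so they denote functions on trees whatever else the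
    store holds. *)
Fixpoint vars0 (e : expr) : bool :=
  match e with
  | EVar x => x == 0
  | ELeaf => true
  | ENode e1 e2 | EEq e1 e2 => vars0 e1 && vars0 e2
  | EHd e1 | ETl e1 => vars0 e1
  end.

Lemma eval_vars0 s e : vars0 e -> eval s e = eval (fun=> s 0) e.
Proof.
elim: e => //= [x /eqP-> //|e1 IH1 e2 IH2 /andP[/IH1<- /IH2<-] //|e1 IH /IH<- //
  |e1 IH /IH<- //|e1 IH1 e2 IH2 /andP[/IH1<- /IH2<-] //].
Qed.

Lemma ecost_vars0 e : vars0 e ->
  exists K, forall s, ecost s e <= K * tsize (s 0).
Proof.
have hd_le t : tsize (if t is Node a _ then a else Leaf) <= tsize t.
  by case: t => //= a b; lia.
have tl_le t : tsize (if t is Node _ b then b else Leaf) <= tsize t.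
  by case: t => //= a b; lia.
elim: e => [x /eqP->|_|e1 IH1 e2 IH2 /andP[/IH1[K1 H1] /IH2[K2 H2]]
  |e1 IH /IH[K H]|e1 IH /IH[K H]|e1 IH1 e2 IH2 /andP[/IH1[K1 H1] /IH2[K2 H2]]].
- by exists 1 => s /=; rewrite addn0 mul1n.
- by exists 1 => s /=; rewrite mul1n tsize_gt0.
- exists (1 + 2 * (K1 + K2)) => s /=.
  have := tsize_eval_le s e1; have := tsize_eval_le s e2.
  have := H1 s; have := H2 s; have := tsize_gt0 (s 0); nia.
- exists (2 * K) => s /=; have := tsize_eval_le s e1.
  by have := hd_le (eval s e1); have := H s; nia.
- exists (2 * K) => s /=; have := tsize_eval_le s e1.
  by have := tl_le (eval s e1); have := H s; nia.
exists (3 + K1 + K2) => s /=.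
have : tsize (enc_bool (tree_eqb (eval s e1) (eval s e2))) <= 3.
  by case: tree_eqb.
have := H1 s; have := H2 s; have := tsize_gt0 (s 0); nia.
Qed.

(* Programs are composed inside larger ones, so they must work from an
   arbitrary store; [N] bounds the variables that [c] may overwrite, which
   makes every variable from [N] on available for saving data. *)
Definition computes (c : cmd) (N : nat) (p : {poly nat}) (f : tree -> tree) :=
  0 < N /\ forall r s i, exists t s',
    [/\ exec r c s i t s' i, s' 0 = f (s 0),
        forall x, N <= x -> s' x = s x,
        t <= pval p (tsize (s 0)) & tsize (f (s 0)) <= pval p (tsize (s 0))].

Definition polyfun (f : tree -> tree) := exists c N p, computes c N p f.

Lemma eq_polyfun f g : f =1 g -> polyfun f -> polyfun g.
Proof. by move=> /funext->. Qed.

Lemma polyfun_expr e : vars0 e -> polyfun (fun v => eval (fun=> v) e).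
Proof.
move=> e0; have [K leK] := ecost_vars0 e0.
exists (Assign 0 e), 1, (cst K * 'X + cst 1)%R; split=> // r s i.
exists (ecost s e).+1, (upd s 0 (eval s e)).
have := leK s; have := tsize_eval_le s e; rewrite !pvalE -(eval_vars0 s e0) => A B.
split; [exact: exec_assign|by []|by case|lia|lia].
Qed.

(** The bound on the output size kept in [computes] is what allows the time bound of the second
    program to be composed with that of the first. *)
Lemma polyfun_comp f g : polyfun f -> polyfun g -> polyfun (g \o f).
Proof.
move=> [c [N [p [N0 Hf]]]] [d [M [q [M0 Hg]]]].
exists (Seq c d), (maxn N M), (p + (q \Po p) + cst 1)%R; split=> [|r s i]; first lia.
have [t [s' [Ec s'0 s'N Et Ef]]] := Hf r s i.
have [u [s'' [Ed s''0 s''M Eu Eg]]] := Hg r s' i.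
exists (t + u).+1, s''; rewrite !pvalE /=.
rewrite s'0 in s''0 Eu Eg; have := leq_pval q Ef => le_q.
split=> //; [exact: exec_seq Ec Ed| |lia|lia].
by move=> x; rewrite geq_max => /andP[xN xM]; rewrite s''M // s'N.
Qed.

Lemma polyfun_if e f g : vars0 e -> polyfun f -> polyfun g ->
  polyfun (fun v => if truth (eval (fun=> v) e) then f v else g v).
Proof.
move=> e0 [c [N [p [N0 Hf]]]] [d [M [q [M0 Hg]]]].
have [K leK] := ecost_vars0 e0.
exists (If e c d), (maxn N M), (p + q + cst K * 'X + cst 1)%R.
split=> [|r s i]; first lia.
have := leK s; rewrite !pvalE -(eval_vars0 s e0); case: ifP => tr leK'.
  have [t [s' [Ec s'0 s'N Et Ef]]] := Hf r s i.
  exists (ecost s e + t).+1, s'; split=> //; [exact: exec_if_true| |lia|lia].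
  by move=> x; rewrite geq_max => /andP[xN xM]; rewrite s'N.
have [t [s' [Ec s'0 s'N Et Ef]]] := Hg r s i.
exists (ecost s e + t).+1, s'; split=> //; [|  |lia|lia].
  by apply: exec_if_false => //; rewrite tr.
by move=> x; rewrite geq_max => /andP[xN xM]; rewrite s'N.
Qed.

Definition thd (t : tree) := if t is Node a _ then a else Leaf.
Definition ttl (t : tree) := if t is Node _ b then b else Leaf.

Lemma tsize_thd t : tsize (thd t) <= tsize t.
Proof. by case: t => //= a b; lia. Qed.

Lemma tsize_ttl t : tsize (ttl t) <= tsize t.
Proof. by case: t => //= a b; lia. Qed.

Lemma tsize_thd_ttl t : tsize (thd t) + tsize (ttl t) <= (tsize t).+1.
Proof. by case: t => //= a b; lia. Qed.

Lemma polyfun_fst f :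
  polyfun f -> polyfun (fun v => Node (f (thd v)) (ttl v)).
Proof.
move=> [c [N [p [N0 Hf]]]].
(* The second component waits in variable [N], which [c] leaves unchanged. *)
exists (Seq (Assign N (ETl (EVar 0))) (Seq (Assign 0 (EHd (EVar 0)))
   (Seq c (Assign 0 (ENode (EVar 0) (EVar N)))))), N.+1,
   (cst 3 * p + cst 7 * 'X + cst 10)%R.
split=> // r s i.
set s1 := upd s N (ttl (s 0)); set s2 := upd s1 0 (thd (s 0)).
have s2N : s2 N = ttl (s 0) by rewrite /s2 /s1 /upd eqxx; case: (N) N0.
have [t [s' [Ec s'0 s'N Et Ef]]] := Hf r s2 i.
have E := conj (tsize_thd (s 0)) (tsize_ttl (s 0)).
have {}s'N' : s' N = ttl (s 0) by rewrite s'N.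
do 2!eexists; split.
- apply: exec_seq; first exact: exec_assign.
  apply: exec_seq; first exact: exec_assign.
  rewrite /= -/(ttl _) -/s1 {2}/s1 {2}/upd.
  have -> : (0 == N) = false by case: (N) N0.
  rewrite -/(thd _) -/s2; apply: exec_seq; first exact: Ec.
  exact: exec_assign.
- by rewrite /upd eqxx /= s'0 s'N' /s2 /upd eqxx.
- move=> x ltNx; rewrite /upd; have -> : (x == 0) = false by lia.
  rewrite s'N ?(ltnW ltNx) // /s2 /s1 /upd.
  have [-> ->] : (x == 0) = false /\ (x == N) = false by lia.
  by [].
- have L := leq_pval p (proj1 E); rewrite /s2 /upd eqxx /= in s'0 Et Ef.
  rewrite !pvalE /= s'0 s'N' /s1 /upd.
  have -> : (0 == N) = false by case: (N) N0.
  rewrite -/(thd _) -/(ttl _); lia.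
rewrite !pvalE /=; have L := leq_pval p (proj1 E).
rewrite /s2 /upd eqxx /= in Ef; lia.
Qed.

Fixpoint tfold (f : tree -> tree) (l a : tree) : tree :=
  if l is Node x l' then tfold f l' (f (Node x a)) else a.

(* Bounding the growth of the accumulator additively keeps the values inside
   the loop polynomial; without it, iterating a polynomial-time function can
   take exponential time. *)
Lemma tsize_tfold f (q : {poly nat}) :
  (forall x a, tsize (f (Node x a)) <= tsize a + pval q (tsize x)) ->
  forall l a, tsize (tfold f l a) <= tsize a + tsize l * pval q (tsize l).
Proof.
move=> fq; elim=> [|x _ l IHl] a /=; first lia.
have := IHl (f (Node x a)); have := fq x a.
have : pval q (tsize x) <= pval q (tsize x + tsize l).+1 by apply: leq_pval; lia.
have : pval q (tsize l) <= pval q (tsize x + tsize l).+1 by apply: leq_pval; lia.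
nia.
Qed.

Lemma polyfun_tfold f (q : {poly nat}) : polyfun f ->
  (forall x a, tsize (f (Node x a)) <= tsize a + pval q (tsize x)) ->
  polyfun (fun v => tfold f (thd v) (ttl v)).
Proof.
move=> [c [N [p [N0 Hf]]]] fq.
have N0' : (0 == N) = false by case: (N) N0.
pose body := Seq (Assign 0 (ENode (EHd (EVar N)) (EVar 0)))
  (Seq c (Assign N (ETl (EVar N)))).
(* [L] bounds the remaining list and [M] every accumulator met by the loop; [W L M] then bounds the
   time of one iteration. *)
pose W L M := pval p (L + M) + 10 * (L + M) + 20.
(* The bound by [M] reserves a growth of [pval q L] for each remaining iteration, which makes it an
   invariant. *)
have loop r i L M l s :
    s N = l -> tsize l <= L -> tsize (s 0) + tsize l * pval q L <= M ->
  exists t s', [/\ exec r (While (EVar N) body) s i t s' i,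
    s' 0 = tfold f l (s 0), forall x, N < x -> s' x = s x &
    t <= tsize l * W L M].
  elim: l s => [|x _ l IHl] s sN leL leM.
    exists (ecost s (EVar N)).+1, s; split=> //.
      by apply: exec_while_false; rewrite /= sN.
    by rewrite /= sN /W /=; lia.
  pose s1 := upd s 0 (Node x (s 0)).
  have [t [s2 [Ec s20 s2N Et Ef]]] := Hf r s1 i.
  have s10 : s1 0 = Node x (s 0) by [].
  have s1N : s1 N = Node x l by rewrite /s1 /upd eq_sym N0'.
  pose s3 := upd s2 N l.
  have s30 : s3 0 = f (Node x (s 0)) by rewrite /s3 /upd N0' s20.
  have s3N : s3 N = l by rewrite /s3 /upd eqxx.
  rewrite s10 in Et Ef; simpl in leL, leM.
  have qL : pval q (tsize x) <= pval q L by apply: leq_pval; lia.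
  have fxa := fq x (s 0).
  have [||t' [s' [Ew s'0 s'N Et']]] := IHl s3 s3N.
  - lia.
  - rewrite s30; nia.
  do 2!eexists; split.
  - apply: exec_while_true; [by rewrite /= sN| |exact: Ew].
    apply: exec_seq; first exact: exec_assign.
    rewrite /= sN -/s1; apply: exec_seq; first exact: Ec.
    have := exec_assign r s2 i N (ETl (EVar N)).
    by rewrite /= s2N // s1N -/s3; apply.
  - by rewrite s'0 s30.
  - move=> y ltNy; rewrite s'N // /s3 /upd.
    have -> : (y == N) = false by lia.
    rewrite s2N ?(ltnW ltNy) // /s1 /upd.
    by have -> : (y == 0) = false by lia.
  have leP : pval p (tsize (Node x (s 0))) <= pval p (L + M).
    by apply: leq_pval => /=; nia.
  rewrite /= sN /=.
  have : tsize (s 0) <= M by nia.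
  have : tsize l * W L M <= (tsize x + tsize l) * W L M.
    by rewrite leq_mul2r leq_addl orbT.
  rewrite mulSn; move: Et' Et leP => /=; move: (_ * W L M) (_ * W L M).
  by rewrite /W; move: (pval p _) (pval p (L + M)); lia.
(* Size of the initial accumulator plus the total growth over the list. *)
pose B := ('X + 'X * q : {poly nat})%R.
exists (Seq (Assign N (EHd (EVar 0))) (Seq (Assign 0 (ETl (EVar 0)))
  (While (EVar N) body))), N.+1,
  ('X * ((p \Po ('X + B)) + cst 10 * ('X + B) + cst 20) + B + cst 6 * 'X + cst 10)%R.
split=> // r s i.
have E := conj (tsize_thd (s 0)) (tsize_ttl (s 0)).
have D : tsize (thd (s 0)) + tsize (ttl (s 0)) <= (tsize (s 0)).+1.
  exact: tsize_thd_ttl.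
set s1 := upd s N (thd (s 0)); set s2 := upd s1 0 (ttl (s 0)).
have s2N : s2 N = thd (s 0) by rewrite /s2 /s1 /upd eqxx eq_sym N0'.
have s20 : s2 0 = ttl (s 0) by [].
have [||t [s' [Ew s'0 s'N Et]]] :=
  loop r i (tsize (s 0)) (pval B (tsize (s 0))) _ s2 s2N.
- exact: (proj1 E).
- by rewrite !pvalE s20; have := E; nia.
do 2!eexists; split.
- apply: exec_seq; first exact: exec_assign.
  apply: exec_seq; first exact: exec_assign.
  rewrite /= -/(thd _) -/s1 {2}/s1 {2}/upd N0' -/(ttl _) -/s2.
  exact: Ew.
- by rewrite s'0 s20.
- move=> y ltNy; rewrite s'N // /s2 /s1 /upd.
  have -> : (y == 0) = false by lia.
  by have -> : (y == N) = false by lia.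
- rewrite /= /s1 /upd N0' -/(thd _) -/(ttl _).
  have : tsize (thd (s 0)) * W (tsize (s 0)) (pval B (tsize (s 0))) <=
         tsize (s 0) * W (tsize (s 0)) (pval B (tsize (s 0))).
    by rewrite leq_mul2r (proj1 E) orbT.
  move: E Et; rewrite !pvalE /W; move: (_ * (_ + _)) (_ * (_ + _)). lia.
have := tsize_tfold fq (thd (s 0)) (ttl (s 0)).
have : pval q (tsize (thd (s 0))) <= pval q (tsize (s 0)) by apply: leq_pval; lia.
rewrite !pvalE; have := E; nia.
Qed.

Fixpoint clear (n : nat) : cmd :=
  if n is m.+1 then Seq (Assign n ELeaf) (clear m) else Skip.

Lemma exec_clear r n s i : exists t,
  exec r (clear n) s i t (fun x => if 0 < x <= n then Leaf else s x) i /\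
  t <= 3 * n + 1.
Proof.
elim: n s => [|n IHn] s /=.
  exists 1; split=> //; have -> : (fun x => if 0 < x <= 0 then Leaf else s x) = s.
    by apply/funext => -[].
  exact: exec_skip.
have [t [Et le_t]] := IHn (upd s n.+1 Leaf).
exists ((ecost s ELeaf).+1 + t).+1; split; last by rewrite /=; lia.
apply: exec_seq; first exact: exec_assign.
rewrite [X in exec _ _ _ _ _ X _](_ : _ =
  fun x => if 0 < x <= n then Leaf else upd s n.+1 Leaf x) //.
apply/funext => x; rewrite /upd; case: eqP => [->|neq_x].
  by rewrite leqnn; case: ifP.
by have -> : (0 < x <= n.+1) = (0 < x <= n) by lia.
Qed.

(** The guarantees of an algorithm concern only runs from an [init_store], so a program placed
    before it must erase its auxiliary variables. Those above [N] are still [Leaf]. *)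
Lemma polyfun_init_store f : polyfun f ->
  exists c (p : {poly nat}), forall v r i, exists t,
    [/\ exec r c (init_store v) i t (init_store (f v)) i,
        t <= pval p (tsize v) & tsize (f v) <= pval p (tsize v)].
Proof.
move=> [c [N [p [N0 Hf]]]].
exists (Seq c (clear N)), (p + cst (3 * N + 2))%R => v r i.
have [t [s' [Ec s'0 s'N Et Ef]]] := Hf r (init_store v) i.
have [u [Eu le_u]] := exec_clear r N s' i.
exists (t + u).+1; rewrite !pvalE; split; [|rewrite /= in Et; lia|rewrite /= in Ef; lia].
apply: exec_seq Ec _; rewrite [X in exec _ _ _ _ _ X _](_ : _ =
  fun x => if 0 < x <= N then Leaf else s' x) //.
apply/funext => -[|x] /=; first by rewrite s'0.
case: ifPn => // x_gt; rewrite s'N //; lia.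
Qed.

(** * Executions and coins *)

Lemma exec_det r c s i t s' i' : exec r c s i t s' i' ->
  forall t2 s2 i2, exec r c s i t2 s2 i2 -> [/\ t2 = t, s2 = s' & i2 = i'].
Proof.
elim=> {c s i t s' i'}.
- by move=> s i t s' i' E; inversion E.
- by move=> s i x e t s' i' E; inversion E.
- by move=> s i x t s' i' E; inversion E.
- move=> c1 c2 s i t1 s1 i1 t2 s2 i2 _ IH1 _ IH2 t s' i' E; inversion E; subst.
  have [? ? ?] := IH1 _ _ _ ltac:(eassumption); subst.
  by have [? ? ?] := IH2 _ _ _ ltac:(eassumption); subst.
- move=> e c1 c2 s i t s' i' tr _ IH t2 s2 i2 E; inversion E; subst.
    by have [? ? ?] := IH _ _ _ ltac:(eassumption); subst.
  by match goal with H : is_true (~~ _) |- _ => rewrite tr in H end.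
- move=> e c1 c2 s i t s' i' tr _ IH t2 s2 i2 E; inversion E; subst.
    by match goal with H : is_true (truth _) |- _ => rewrite H in tr end.
  by have [? ? ?] := IH _ _ _ ltac:(eassumption); subst.
- move=> e c s i tr t2 s2 i2 E; inversion E; subst=> //.
  by match goal with H : is_true (truth _) |- _ => rewrite H in tr end.
move=> e c s i t1 s1 i1 t2 s2 i2 tr _ IH1 _ IH2 t s' i' E; inversion E; subst.
  by match goal with H : is_true (~~ _) |- _ => rewrite tr in H end.
have [? ? ?] := IH1 _ _ _ ltac:(eassumption); subst.
by have [? ? ?] := IH2 _ _ _ ltac:(eassumption); subst.
Qed.

Lemma runs_det c v r t y t' y' :
  runs c v r t y -> runs c v r t' y' -> t' = t /\ y' = y.
Proof.
move=> [s [i [E <-]]] [s' [i' [E' <-]]].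
by have [-> -> _] := exec_det E E'.
Qed.

(** An assignment costs at least the size of the value it stores. The factor 2 comes from [Flip],
    which in one unit of time may replace a tree of size 1 by one of size 3. *)
Lemma tsize_exec r c s i t s' i' : exec r c s i t s' i' ->
  forall x, tsize (s' x) <= tsize (s x) + 2 * t.
Proof.
elim=> {c s i t s' i'}.
- by move=> *; lia.
- move=> s i x e y; rewrite /upd; case: eqP => _; last by lia.
  by have := tsize_eval_le s e; lia.
- move=> s i x y; rewrite /upd; case: eqP => _; last by lia.
  by case: (r i); have := tsize_gt0 (s y); rewrite /=; lia.
- by move=> c1 c2 s i t1 s1 i1 t2 s2 i2 _ IH1 _ IH2 x; have := IH1 x; have := IH2 x; lia.
- by move=> e c1 c2 s i t s' i' _ _ IH x; have := IH x; lia.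
- by move=> e c1 c2 s i t s' i' _ _ IH x; have := IH x; lia.
- by move=> *; lia.
by move=> e c s i t1 s1 i1 t2 s2 i2 _ _ IH1 _ IH2 x; have := IH1 x; have := IH2 x; lia.
Qed.

Lemma exec_coins r c s i t s' i' : exec r c s i t s' i' -> i <= i' <= i + t.
Proof. by elim=> *; lia. Qed.

Lemma eq_exec r r' c s i t s' i' : exec r c s i t s' i' ->
  (forall j, j < i' -> r j = r' j) -> exec r' c s i t s' i'.
Proof.
elim=> {c s i t s' i'}.
- by move=> *; apply: exec_skip.
- by move=> *; apply: exec_assign.
- by move=> s i x eq_r; rewrite eq_r //; apply: exec_flip.
- move=> c1 c2 s i t1 s1 i1 t2 s2 i2 _ IH1 E2 IH2 eq_r.
  apply: exec_seq (IH2 eq_r); apply: IH1 => j ltj; apply: eq_r.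
  by have := exec_coins E2; lia.
- by move=> *; apply: exec_if_true; auto.
- by move=> *; apply: exec_if_false; auto.
- by move=> *; apply: exec_while_false.
move=> e c s i t1 s1 i1 t2 s2 i2 tr _ IH1 E2 IH2 eq_r.
apply: exec_while_true tr _ (IH2 eq_r); apply: IH1 => j ltj; apply: eq_r.
by have := exec_coins E2; lia.
Qed.

Lemma eq_runs r r' c v t y : runs c v r t y ->
  (forall j, j < t -> r j = r' j) -> runs c v r' t y.
Proof.
move=> [s [i [E s0]]] eq_r; exists s, i; split=> //.
apply: (eq_exec E) => j ltj; apply: eq_r.
by have := exec_coins E; lia.
Qed.

(** Each of the [T]-tuples counted for [E] has [2 ^ (T' - T)] extensions, all counted for [E'], and
    concatenation is injective. *)
Lemma le_prob T T' (E E' : (nat -> bool) -> Prop) : T <= T' ->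
  (forall r r', (forall j, j < T -> r j = r' j) -> E r -> E' r') ->
  (prob T E <= prob T' E')%R.
Proof.
move=> /subnKC <-; move: (T' - T) => d EE'; rewrite /prob.
set A := [set u | _]; set A' := [set u | _].
have cardA : #|A| * 2 ^ d <= #|A'|.
  have -> : #|A| * 2 ^ d = #|setX A [set: d.-tuple bool]|.
    by rewrite cardsX cardsT card_tuple card_bool.
  pose h (p : T.-tuple bool * d.-tuple bool) := cat_tuple p.1 p.2.
  have hI : injective h.
    move=> [u w] [u' w'] /(congr1 val) /= /eqP.
    rewrite eqseq_cat ?size_tuple // => /andP[/eqP/val_inj-> /eqP/val_inj->].
    by [].
  rewrite -(card_imset _ hI); apply: subset_leq_card.
  apply/subsetP => _ /imsetP[[u w] /[!inE] /andP[/asboolP Eu _] ->].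
  apply/asboolP; apply: EE' Eu => j ltj.
  by rewrite nth_cat size_tuple ltj.
have gt0 n : (0 < 2 ^+ n :> rat)%R by rewrite exprn_gt0.
rewrite ler_pdivrMr // mulrAC ler_pdivlMr // exprD.
rewrite mulrCA [leRHS]mulrC ler_pM2l //.
by rewrite -natrX -natrM ler_nat.
Qed.

(** A run of [c] reads at most [T] coins, so its success depends only on the first [T] coins, as
    [le_prob] requires. *)
Lemma le_prob_runs c c' v v' T T' (ok ok' : tree -> Prop) : T <= T' ->
  halts_within c v T ->
  (forall r t y, runs c v r t y -> ok y ->
     exists t' y', runs c' v' r t' y' /\ ok' y') ->
  (prob T (fun r => exists t y, runs c v r t y /\ ok y) <=
   prob T' (fun r => exists t y, runs c' v' r t y /\ ok' y))%R.
Proof.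
move=> leT hT cc'; apply: le_prob => // r r' eq_r [t [y [Ey oky]]].
have [t1 [y1 [E1 le_t1]]] := hT r; have [tE _] := runs_det Ey E1.
apply: cc' oky; apply: (eq_runs Ey) => j ltj; apply: eq_r; lia.
Qed.

(** * Cycle covers and their weights *)

Definition cedges (V : eqType) (c : seq V) : seq (V * V) :=
  [seq (x, next c x) | x <- c].

(** Through their sources, edges inherit distinctness from the vertices. *)
Lemma unzip1_cedges (V : eqType) (c : seq V) : unzip1 (cedges c) = c.
Proof. by rewrite /unzip1 -map_comp map_id. Qed.

Lemma unzip1_flatten_cedges (V : eqType) (cs : seq (seq V)) :
  unzip1 (flatten (map (@cedges V) cs)) = flatten cs.
Proof.
rewrite /unzip1 map_flatten -map_comp; congr flatten.
by rewrite -[RHS]map_id; apply: eq_map => c; apply: unzip1_cedges.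
Qed.

Lemma mem_cedges (V : eqType) (c : seq V) e :
  (e \in cedges c) = (e.1 \in c) && (e.2 == next c e.1).
Proof.
apply/mapP/andP => [[x xc ->]|[ec /eqP e2]]; first by rewrite /= xc.
by exists e.1; rewrite // -e2; case: (e).
Qed.

Lemma next_neq (V : eqType) (c : seq V) x :
  uniq c -> 1 < size c -> x \in c -> next c x != x.
Proof.
move=> Uc c_gt1 xc; have [i p rc] := rot_to xc.
rewrite -(next_rot i Uc) rc; move: Uc c_gt1.
rewrite -(rot_uniq i) -(size_rot i) rc; case: p {rc} => //= y p.
by rewrite eqxx inE eq_sym negb_or => /andP[/andP[]].
Qed.

Section CycleCovers.

Variable n : nat.
Implicit Types (cs : seq (seq 'I_n)) (C D S : {set 'I_n * 'I_n}).

Lemma cycle_edgesE (c : seq 'I_n) : cycle_edges c = [set:: cedges c].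
Proof. by apply/setP => e; rewrite !inE mem_cedges. Qed.

Lemma mem_bigcup_cycle_edges cs e :
  (e \in \bigcup_(c <- cs) cycle_edges c) = (e \in flatten (map (@cedges _) cs)).
Proof.
elim: cs => [|c cs IHcs] /=; first by rewrite big_nil inE.
by rewrite big_cons inE mem_cat IHcs cycle_edgesE inE.
Qed.

Lemma uniq_cycles_of C cs : cycles_of C cs -> uniq (flatten cs).
Proof. by move=> [_ /perm_uniq-> _]; apply: enum_uniq. Qed.

(** Every vertex is the source of exactly one edge. *)
Lemma card_cycle_cover C : cycle_cover C -> #|C| = n.
Proof.
move=> [cs CC]; have U := uniq_cycles_of CC; have [_ P ->] := CC.
rewrite (eq_card (mem_bigcup_cycle_edges cs)).
have Ue : uniq (flatten (map (@cedges _) cs)).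
  by apply: (@map_uniq _ _ fst); rewrite -/(unzip1 _) unzip1_flatten_cedges.
rewrite (card_uniqP Ue) -(size_map fst) -/(unzip1 _) unzip1_flatten_cedges.
by rewrite (perm_size P) size_enum_ord.
Qed.

(** Needed because [weights12] constrains weights off the diagonal only. *)
Lemma cycle_cover_loopless C e : cycle_cover C -> e \in C -> e.1 != e.2.
Proof.
move=> [cs CC]; have U := uniq_cycles_of CC; have [/allP gt1 _ ->] := CC.
rewrite mem_bigcup_cycle_edges => /flattenP[_ /mapP[c c_cs ->]].
rewrite mem_cedges => /andP[ec /eqP->]; rewrite eq_sym.
apply: next_neq => //; last exact: gt1.
have /perm_uniq := perm_flatten (perm_to_rem c_cs).
by rewrite U /= cat_uniq => /esym/andP[].
Qed.

Lemma hamiltonian_cycle_cover S : hamiltonian S -> cycle_cover S.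
Proof.
move=> [c [c_gt1 Pc ->]]; exists [:: c]; split; rewrite /= ?c_gt1 ?cats0 //.
by rewrite big_seq1.
Qed.

(* Every cycle has at least two vertices. *)
Lemma card_patched C D cs : cycles_of C cs -> D \subset C ->
  (forall c, c \in cs -> #|D :&: cycle_edges c| = 1) -> 2 * #|D| <= n.
Proof.
move=> [/allP gt1 P ->] /setIidPl sD D1.
apply: (@leq_trans (2 * size cs)).
  rewrite leq_mul2l /= -{}sD.
  elim: cs D1 {gt1 P} => [|c cs IHcs] D1; first by rewrite big_nil setI0 cards0.
  rewrite big_cons setIUr (leq_trans (leq_card_setU _ _)) //= -add1n.
  rewrite leq_add ?D1 ?mem_head //; apply: IHcs => d dcs; apply: D1.
  by rewrite inE dcs orbT.
rewrite -[leqRHS]size_enum_ord -(perm_size P) size_flatten.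
elim: cs gt1 {P D1 sD} => //= c cs IHcs gt1.
rewrite mulnS leq_add ?gt1 ?mem_head //; apply: IHcs => d dcs; apply: gt1.
by rewrite inE dcs orbT.
Qed.

End CycleCovers.

Section Weights.

Variables (k : nat) (x : inst k).
Hypothesis x12 : weights12 x.
Implicit Types (C D S : {set 'I_(nv x) * 'I_(nv x)}) (i : 'I_k).

Lemma weight_bounds i C S : cycle_cover C -> S \subset C ->
  #|S| <= weight i S <= 2 * #|S|.
Proof.
move=> CC /subsetP sSC; rewrite /weight -sum1_card big_distrr /=.
by apply/andP; split; apply: leq_sum => e /sSC /(cycle_cover_loopless CC) /(x12 i);
  rewrite !inE => /orP[] /eqP->.
Qed.

Lemma weight_patched i C S : patched C S -> 2 * weight i S <= 3 * weight i C.
Proof.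
move=> [cs [D [CC sDC D1 HS sCDS]]].
have D2 := card_patched CC sDC D1.
have {}CC : cycle_cover C by exists cs.
have SS := hamiltonian_cycle_cover HS.
have cardC := card_cycle_cover CC; have cardS := card_cycle_cover SS.
(* As [C] and [S] both have [n] edges, [S] has exactly [#|D|] edges outside [C :\: D]. They weigh at
   most [2 * #|D|], against at least [#|D|] for the removed ones. *)
have wC : weight i C = weight i D + weight i (C :\: D).
  by rewrite /weight (big_setID D) /= (setIidPr sDC).
have wS : weight i S = weight i (C :\: D) + weight i (S :\: (C :\: D)).
  by rewrite /weight (big_setID (C :\: D)) /= (setIidPr sCDS).
have := weight_bounds i SS (subsetDl S (C :\: D)).
have := weight_bounds i CC sDC; have := weight_bounds i CC (subxx C).
have := cardsID D C; rewrite (setIidPr sDC).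
have := cardsID (C :\: D) S; rewrite (setIidPr sCDS).
by move: cardC cardS; lia.
Qed.

End Weights.

Lemma approx_pareto_patched (k : nat) (x : inst k)
    (P Q : {set {set 'I_(nv x) * 'I_(nv x)}}) :
  weights12 x -> approx_pareto (@cycle_cover (nv x)) 1%R P ->
  patched_family P Q -> approx_pareto (@hamiltonian (nv x)) (3 / 2)%R Q.
Proof.
move=> x12 [_ optP] [PQ QP]; split=> [S /QP[C _ [cs [D []]]] //|Z HZ].
have [C CP leC] := optP Z (hamiltonian_cycle_cover HZ).
have [S SQ pCS] := PQ C CP; exists S => // i.
have := leC i; rewrite mul1r ler_nat => leCZ.
rewrite mulrAC ler_pdivlMr // -!natrM ler_nat.
have := weight_patched x12 i pCS; lia.
Qed.

(** On every coin stream on which [B] succeeds, [A] succeeds too, so the success probability of [B]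
    carries over. *)
Lemma patching_approximation (k : nat) (B A : cmd) :
  cycle_cover_pareto12 k B -> polytime12 k A -> implements_patching k B A ->
  atsp12_approximation k (3 / 2)%R A.
Proof.
move=> [p Bp] [q Aq] BA; exists (p + q)%R => x x12 T.
have [hB prB] := Bp x x12; have hA := Aq x x12.
have leT : pval p (tsize (enc_inst x)) <= T /\ pval q (tsize (enc_inst x)) <= T.
  by rewrite /T pvalE; lia.
split=> [r|]; first by have [t [y [E le_t]]] := hA r; exists t, y; split=> //; lia.
apply: le_trans prB _; apply: le_prob_runs hB _; first exact: (proj1 leT).
move=> r t y Ey [P yP optP].
have [t' [y' [Q [Ey' y'Q PQ]]]] := BA x r t y P x12 Ey yP (proj1 optP).
by exists t', y'; split=> //; exists Q => //; apply: approx_pareto_patched PQ.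
Qed.

(** * Exact Pareto curves of cycle covers *)

Lemma approx_pareto_exact (k : nat) (x : inst k) (m : nat)
    (P : {set {set 'I_(nv x) * 'I_(nv x)}}) :
  weights12 x -> 2 * nv x < m ->
  approx_pareto (@cycle_cover (nv x)) (1 + m%:R^-1)%R P ->
  approx_pareto (@cycle_cover (nv x)) 1%R P.
Proof.
move=> x12 lt_m [PC opt]; split=> // Z CZ; have [C CP leC] := opt Z CZ.
exists C => // i; have := leC i; rewrite mul1r.
have := weight_bounds x12 i CZ (subxx Z); rewrite (card_cycle_cover CZ).
move=> /andP[_ leZ]; have m0 : (0 < m%:R :> rat)%R by rewrite ltr0n; lia.
rewrite -(ler_pM2l m0) mulrA mulrDr mulfV ?gt_eqF // mulr1 natr1 -!natrM !ler_nat mulSn.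
(* If [C] weighed at least one more than [Z], [le_w] would give [m <= weight i Z], against
   [weight i Z <= 2 * nv x < m]. *)
move=> le_w; rewrite leqNgt; apply/negP => /(leq_mul (leqnn m)).
rewrite mulnS; lia.
Qed.

Definition double_step (v : tree) : tree :=
  Node (thd (ttl v)) (Node Leaf (Node Leaf (ttl (ttl v)))).

(** The head of an encoded instance is its number of vertices in unary; folding over it adds 2 per
    vertex to a counter started at 1. *)
Definition double_odd (v : tree) : tree :=
  tfold double_step (thd v) (Node v (Node Leaf Leaf)).

Lemma double_odd_enc (k : nat) (x : inst k) :
  double_odd (enc_inst x) = Node (enc_inst x) (enc_unary (2 * nv x).+1).
Proof.
have step v n m : tfold double_step (enc_unary n) (Node v (enc_unary m)) =
                  Node v (enc_unary (2 * n + m)).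
  elim: n m => [//|n IHn m].
  rewrite -[LHS]/(tfold _ (enc_unary n) (Node v (enc_unary m.+2))) IHn.
  by have -> : 2 * n + m.+2 = 2 * n.+1 + m by lia.
by rewrite /double_odd (step _ _ 1) addn1.
Qed.

Lemma polyfun_double_odd : polyfun double_odd.
Proof.
have stepP : polyfun double_step.
  exact: (@polyfun_expr (ENode (EHd (ETl (EVar 0)))
    (ENode ELeaf (ENode ELeaf (ETl (ETl (EVar 0))))))).
have initP : polyfun (fun v => Node (thd v) (Node v (Node Leaf Leaf))).
  exact: (@polyfun_expr (ENode (EHd (EVar 0)) (ENode (EVar 0) (ENode ELeaf ELeaf)))).
apply: (eq_polyfun _ (polyfun_comp initP (polyfun_tfold (q := cst 10) stepP _))) => //.
by move=> y a; rewrite pvalE; have := tsize_thd_ttl a; rewrite /=; lia.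
Qed.

(** The program that prepares the accuracy flips no coin, so the scheme sees the same coin stream as
    it would alone. *)
Lemma cycle_cover_pareto12_exists (k : nat) (F : cmd) :
  cycle_cover_fpras k F -> exists B, cycle_cover_pareto12 k B.
Proof.
move=> [p Fp]; have [c [q Hc]] := polyfun_init_store polyfun_double_odd.
exists (Seq c F), (q + (p \Po q) + cst 1)%R => x x12 T.
pose xm := (x, (2 * nv x).+1).
have [|hF prF] := Fp xm.
  by split=> // i u v /(x12 i); rewrite !inE => /orP[] /eqP->.
move: hF prF; rewrite -[xm.1]/x -[xm.2]/(2 * nv x).+1 -double_odd_enc => hF prF.
have run r t y : runs F (double_odd (enc_inst x)) r t y ->
    exists t', runs (Seq c F) (enc_inst x) r (t' + t).+1 y /\
               t' <= pval q (tsize (enc_inst x)).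
  move=> [s [i [E s0]]]; have [t' [Et' le_t' _]] := Hc (enc_inst x) r 0.
  by exists t'; split=> //; exists s, i; split=> //; apply: exec_seq Et' E.
have leT : pval p (tsize (double_odd (enc_inst x))) <=
           pval p (pval q (tsize (enc_inst x))).
  by apply: leq_pval; have [t [_ _]] := Hc (enc_inst x) xpred0 0.
split=> [r|].
  have [t [y [/run[t' [E le_t']] le_t]]] := hF r.
  have := leq_trans le_t leT.
  by exists (t' + t).+1, y; split=> //; rewrite /T !pvalE; lia.
apply: le_trans prF _; apply: le_prob_runs hF _; first by rewrite /T !pvalE; lia.
move=> r t y /run[t' [E _]] [P yP optP].
exists (t' + t).+1, y; split=> //; exists P => //.
exact: approx_pareto_exact x12 (ltnSn _) optP.
Qed.

(** * Traversing a cycle cover *)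

Section Traversal.

Variable V : eqType.
Implicit Types (x y cur : V) (c p : seq V) (cs : seq (seq V)) (e : V * V)
  (l : seq (V * V)).

(** A single fold brings an edge leaving [cur] to the front: once such an edge is at the head, later
    ones are inserted behind it. *)
Definition pull_ins cur l e : seq (V * V) :=
  if l is h :: t then if h.1 == cur then h :: e :: t else e :: l else [:: e].

Definition pull cur l := foldl (pull_ins cur) [::] l.

Lemma perm_pull cur l : perm_eq (pull cur l) l.
Proof.
have ins acc e : perm_eq (e :: acc) (pull_ins cur acc e).
  case: acc => [|h t] /=; first exact: perm_refl.
  case: ifP => _; last exact: perm_refl.
  by rewrite -[e :: _]/([:: e] ++ [:: h] ++ t) perm_catCA perm_refl.
rewrite /pull -[X in perm_eq _ X]cats0.
elim: l [::] => //= e l IHl acc; rewrite (permPl (IHl _)).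
by rewrite -(cat1s e (l ++ acc)) perm_sym perm_catCA perm_cat2l; exact: ins.
Qed.

Lemma pull_head cur l : has (fun e => e.1 == cur) l ->
  exists e r, pull cur l = e :: r /\ e.1 = cur.
Proof.
pose headed acc := has (fun e => e.1 == cur) acc ->
  exists e r, acc = e :: r /\ e.1 = cur.
have headed_ins acc e : headed acc -> headed (pull_ins cur acc e).
  case: acc => [_|h t] /=.
    by rewrite /headed /= orbF => /eqP e1; exists e, [::].
  case: ifP => [/eqP h1 _ _|h1 accP]; first by exists h, (e :: t).
  rewrite /headed /= h1 => /orP[/eqP e1|t1]; first by exists e, (h :: t).
  by have [|h' [t' [[<- _] /eqP]]] := accP; rewrite /= ?t1 ?orbT ?h1.
rewrite -(perm_has _ (perm_pull cur l)); rewrite /pull -/(headed _).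
have : headed [::] by [].
by elim: l [::] => //= e l IHl acc accP; apply: IHl; apply: headed_ins.
Qed.

(* The sources of the edges of [l] in the order of a traversal that follows
   the edge leaving the current vertex while there is one left, and restarts
   with an arbitrary remaining edge otherwise. *)
Fixpoint walk (n : nat) cur l : seq V :=
  if n is n'.+1 then
    if pull cur l is e :: r then e.1 :: walk n' e.2 r else [::]
  else [::].

Lemma cedges_cons x p : uniq (x :: p) -> cedges (x :: p) = zip (x :: p) (rcons p x).
Proof.
rewrite /cedges /next.
(* The vertex to which the last edge returns is separated from the first vertex, to allow induction
   on the list. *)
suff gen y : uniq (x :: p) ->
  [seq (w, next_at w y x p) | w <- x :: p] = zip (x :: p) (rcons p y) by exact: gen.
elim: p x => [|z p IHp] x; first by rewrite /= eqxx.
move=> /andP[x_zp Uzp]; rewrite [RHS]/= map_cons; congr (_ :: _).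
  by rewrite /= eqxx.
rewrite -IHp //; apply/eq_in_map => w w_zp /=.
by have /negPf-> : w != x by apply: contraNneq x_zp => <-.
Qed.

Lemma cedges_rot i c : uniq c -> cedges (rot i c) = rot i (cedges c).
Proof.
move=> Uc; rewrite /cedges map_rot; congr rot.
by apply: eq_map => x; rewrite next_rot.
Qed.

(** Since all sources are distinct, only one remaining edge leaves the current vertex, so [pull] can
    only bring the next edge of the path to the front. *)
Lemma walk_path x p y rest l m :
  perm_eq l (zip (x :: p) (rcons p y) ++ rest) ->
  uniq (x :: p ++ unzip1 rest) ->
  exists2 l', perm_eq l' rest &
    walk (size (x :: p) + m) x l = (x :: p) ++ walk m y l'.
Proof.
elim: p x l => [|z p IHp] x l; rewrite [zip _ _]/= cat_cons => Pl /andP[x_notin U].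
- have [|e [r [pl e1]]] := @pull_head x l.
    by apply/hasP; exists (x, y); rewrite ?(perm_mem Pl) ?mem_head ?eqxx.
  have := perm_trans (perm_pull x l) Pl; rewrite pl => Pr.
  have : e \in (x, y) :: rest by rewrite -(perm_mem Pr) mem_head.
  rewrite inE => /orP[/eqP eE|e_rest].
    by exists r; [rewrite -(perm_cons e) {2}eE|rewrite /= pl eE].
  by case/negP: x_notin; rewrite -e1; apply: map_f.
have [|e [r [pl e1]]] := @pull_head x l.
  by apply/hasP; exists (x, z); rewrite ?(perm_mem Pl) ?mem_head ?eqxx.
have := perm_trans (perm_pull x l) Pl; rewrite pl => Pr.
have : e \in (x, z) :: (zip (z :: p) (rcons p y) ++ rest).
  by rewrite -(perm_mem Pr) mem_head.
rewrite inE => /orP[/eqP eE|e_rest]; last first.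
  case/negP: x_notin; rewrite -e1.
  have -> : (z :: p) ++ unzip1 rest = unzip1 (zip (z :: p) (rcons p y) ++ rest).
    by rewrite /unzip1 map_cat -/unzip1 unzip1_zip ?size_rcons.
  exact: map_f.
have [|//|l' Pl' wE] := IHp z r; first by rewrite -(perm_cons e) {2}eE.
by exists l' => //; rewrite /= pl eE; congr (_ :: _); apply: wE.
Qed.

(** By induction on the number of cycles: the first edge pulled, whichever it is, lies on some cycle
    [c]. The walk goes once around [c], rotated to start at the source of that edge, and goes on
    with the other cycles. Thus [cs'] is [cs] up to the order of the cycles and their starting
    points. *)
Lemma walk_cycles cs cur l :
  all (fun c => 1 < size c) cs -> uniq (flatten cs) ->
  perm_eq l (flatten (map (@cedges V) cs)) ->
  exists cs', [/\ all (fun c => 1 < size c) cs',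
    perm_eq (flatten cs') (flatten cs),
    perm_eq (flatten (map (@cedges V) cs')) l &
    walk (size l) cur l = flatten cs'].
Proof.
elim: {cs}(size cs) {-2}cs (erefl (size cs)) cur l => [|m IHm] cs.
  by move=> /size0nil-> cur l _ _ /perm_nilP->; exists [::].
move=> sz_cs cur l gt1 U Pl; have Pp := perm_trans (perm_pull cur l) Pl.
case pE : (pull cur l) => [|e r].
  move: Pp; rewrite pE perm_sym => /perm_nilP /(congr1 (@unzip1 _ _)).
  rewrite unzip1_flatten_cedges; case: cs sz_cs gt1 {U Pl} => //= c cs _.
  by case: c.
have /flattenP[_ /mapP[c c_cs ->] ec] : e \in flatten (map (@cedges V) cs).
  by rewrite -(perm_mem Pp) pE mem_head.
have Pcs := perm_to_rem c_cs; set cs1 := rem c cs in Pcs.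
have Pf := perm_flatten Pcs.
have /andP[c_gt1 gt1'] : (1 < size c) && all (fun c => 1 < size c) cs1.
  by rewrite -[_ && _]/(all _ (c :: cs1)) -(perm_all _ Pcs).
have U' : uniq (c ++ flatten cs1) by rewrite -(perm_uniq Pf).
have Uc : uniq c by move: U'; rewrite cat_uniq => /andP[].
have e1c : e.1 \in c by move: ec; rewrite mem_cedges => /andP[].
have [i p rc] := rot_to e1c.
have Prc : perm_eq (e.1 :: p) c by rewrite -rc perm_rot.
have Uxp : uniq (e.1 :: p) by rewrite (perm_uniq Prc).
have Pec : perm_eq (zip (e.1 :: p) (rcons p e.1)) (cedges c).
  by rewrite -cedges_cons // -rc cedges_rot // perm_rot.
have Pr : perm_eq (e :: r) (zip (e.1 :: p) (rcons p e.1) ++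
                            flatten (map (@cedges V) cs1)).
  rewrite -pE; apply: perm_trans Pp _.
  by rewrite (permPl (perm_flatten (perm_map _ Pcs))) /= perm_cat2r perm_sym.
have U1 : uniq ((e.1 :: p) ++ unzip1 (flatten (map (@cedges V) cs1))).
  rewrite unzip1_flatten_cedges (@perm_uniq _ _ (c ++ flatten cs1)) //.
  by rewrite perm_cat2r.
have {}c_gt1 : 0 < size p.
  by rewrite -ltnS -[(size p).+1]/(size (e.1 :: p)) (perm_size Prc).
case: p c_gt1 {rc} => // z p _ in Prc Uxp Pec Pr U1 *.
(* [e] is the edge of the rotated cycle with source [e.1], that is, its first edge. *)
have eE : e = (e.1, z).
  have : e \in zip (e.1 :: z :: p) (rcons (z :: p) e.1).
    by rewrite (perm_mem Pec).
  rewrite [zip _ _]/= inE => /orP[/eqP //|].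
  move=> /(map_f fst); rewrite -/(unzip1 _) unzip1_zip ?size_rcons // => e1.
  by move: Uxp => /= /andP[]; rewrite e1.
have {}Pr : perm_eq r (zip (z :: p) (rcons p e.1) ++ flatten (map (@cedges V) cs1)).
  by rewrite -(perm_cons e) {2}eE.
have szl : size l = (size (z :: p) + size (flatten (map (@cedges V) cs1))).+1.
  rewrite -(perm_size (perm_pull cur l)) pE /= (perm_size Pr) size_cat.
  by rewrite size1_zip ?size_rcons.
(* The first edge need not leave [cur], so the path lemma is applied from the second vertex [z]
   on. *)
have [|l' Pl' wE] := walk_path (size (flatten (map (@cedges V) cs1))) Pr.
  by move: U1 => /= /andP[].
have sz1 : size cs1 = m by apply/eqP; rewrite -eqSS -sz_cs (perm_size Pcs).
have Ucs1 : uniq (flatten cs1) by move: U'; rewrite cat_uniq => /and3P[].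
have [cs' [gt1s P1 P2 w']] := IHm cs1 sz1 e.1 l' gt1' Ucs1 Pl'.
exists ((e.1 :: z :: p) :: cs'); split.
- by rewrite /= gt1s.
- by rewrite (permPr Pf) /= -!cat_cons; apply: perm_cat.
- rewrite (permPr (_ : perm_eq l (e :: r))); last by rewrite -pE perm_sym perm_pull.
  rewrite -[flatten _]/(cedges (e.1 :: z :: p) ++ flatten (map (@cedges V) cs')).
  rewrite cedges_cons // [zip _ _]/= -eE cat_cons perm_cons (permPr Pr).
  rewrite perm_cat2l; apply: perm_trans P2 Pl'.
rewrite szl -(perm_size Pl') -[LHS]/(if pull cur l is d :: q then
  d.1 :: walk (size (z :: p) + size l') d.2 q else [::]) pE.
by rewrite -(perm_size Pl') in wE; rewrite (_ : e.2 = z) ?wE ?w' // eE.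
Qed.

Lemma zip_belast_split x p e : e \in zip (belast x p) p ->
  exists q1 q2, x :: p = q1 ++ e.1 :: e.2 :: q2.
Proof.
elim: p x => //= y p IHp x; rewrite inE => /orP[/eqP->|/IHp[q1 [q2 ->]]].
  by exists [::], p.
by exists (x :: q1), q2.
Qed.

Lemma next_cat_cons q1 x y q2 : uniq (q1 ++ x :: y :: q2) ->
  next (q1 ++ x :: y :: q2) x = y.
Proof.
move=> U; rewrite -(next_rot (size q1) U) rot_size_cat /=.
by rewrite eqxx.
Qed.

Lemma flatten_uniq_inj cs c c' x : uniq (flatten cs) ->
  c \in cs -> c' \in cs -> x \in c -> x \in c' -> c = c'.
Proof.
elim: cs => //= d cs IHcs; rewrite cat_uniq => /and3P[_ /hasPn dis U].
have notd b : b \in cs -> x \in b -> x \notin d.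
  by move=> b_cs xb; apply: dis; apply/flattenP; exists b.
rewrite !inE => /orP[/eqP->|c_cs] /orP[/eqP->|c'_cs] // xc xc'.
- by have := notd _ c'_cs xc'; rewrite xc.
- by have := notd _ c_cs xc; rewrite xc'.
exact: IHcs.
Qed.

(** These are the edges of the closed tour along the walk, which starts at [e.1]. The [zip] form is
    the one the program builds. *)
Definition patch_edges l : seq (V * V) :=
  if l is e :: _ then
    let c := walk (size l) e.1 l in zip c (rcons (behead c) e.1)
  else [::].

End Traversal.

Lemma patched_flatten n (cs : seq (seq 'I_n)) C : 1 < n -> cycles_of C cs ->
  patched C (cycle_edges (flatten cs)).
Proof.
move=> n_gt1 CC; have U := uniq_cycles_of CC; have [gt1 P CE] := CC.
(* The removed edge of each cycle leads from its last vertex back to its first; all others join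
   neighbours in [flatten cs]. *)
pose closing (c : seq 'I_n) := if c is x :: p then [:: (last x p, x)] else [::].
pose D := [set:: flatten (map closing cs)].
have zipE (x : 'I_n) p :
    zip (x :: p) (rcons p x) = rcons (zip (belast x p) p) (last x p, x).
  by rewrite lastI zip_rcons // size_belast.
have uniq_cs c : c \in cs -> uniq c.
  move=> /perm_to_rem/perm_flatten/perm_uniq; rewrite U /= cat_uniq.
  by move=> /esym/andP[].
have closingP c e : c \in cs -> e \in closing c -> e \in cedges c.
  move=> /uniq_cs; case: c => // x p Uc; rewrite inE => /eqP->.
  by rewrite cedges_cons // zipE mem_rcons mem_head.
exists cs, D; split=> //.
- apply/subsetP => e; rewrite CE mem_bigcup_cycle_edges inE.
  move=> /flattenP[_ /mapP[c c_cs ->] ec]; apply/flattenP.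
  by exists (cedges c); [apply: map_f|apply: closingP].
- move=> c c_cs; have := allP gt1 c c_cs.
  case cE : c => [//|x p] _.
  rewrite (_ : _ :&: _ = [set (last x p, x)]) ?cards1 // -cE cycle_edgesE.
  apply/setP => e; rewrite !inE; apply/andP/eqP => [[]|->].
    (* Two cycles sharing a source coincide, so [D] meets [c] in no closing edge but its own. *)
    move=> /flattenP[_ /mapP[d d_cs ->] ed] ec.
    have := closingP _ _ d_cs ed; rewrite mem_cedges => /andP[e1d _].
    move: ec; rewrite mem_cedges => /andP[e1c _].
    move: ed; rewrite (flatten_uniq_inj U d_cs c_cs e1d e1c) cE.
    by rewrite inE => /eqP.
  have el : (last x p, x) \in closing c by rewrite cE mem_head.
  split; last exact: closingP el.
  by apply/flattenP; exists (closing c) => //; apply: map_f.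
- exists (flatten cs); split=> //.
  by rewrite (perm_size P) size_enum_ord.
apply/subsetP => e; rewrite inE CE mem_bigcup_cycle_edges inE => /andP[eD].
move=> /flattenP[_ /mapP[c c_cs ->]]; have Uc := uniq_cs c c_cs.
have [d1 [d2 cs12]] : exists d1 d2, flatten cs = d1 ++ c ++ d2.
  have [s1 s2] := splitPr c_cs; exists (flatten s1), (flatten s2).
  by rewrite flatten_cat.
case cE : c Uc => [|x p] Uc; first by rewrite mem_cedges.
rewrite cedges_cons // zipE mem_rcons inE => /orP[/eqP eE|].
  case/negP: eD; apply/flattenP; exists (closing c); first exact: map_f.
  by rewrite cE eE mem_head.
move=> /zip_belast_split[q1 [q2 pE]]; move: U.
rewrite cycle_edgesE inE mem_cedges cs12 cE pE -!catA !cat_cons catA => U.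
by rewrite next_cat_cons // eqxx mem_cat mem_head orbT.
Qed.

Lemma patch_edges_patched n (l : seq ('I_n * 'I_n)) : 1 < n -> uniq l ->
  cycle_cover [set:: l] ->
  uniq (patch_edges l) /\ patched [set:: l] [set:: patch_edges l].
Proof.
move=> n_gt1 Ul [cs CC]; have U := uniq_cycles_of CC; have [gt1 P CE] := CC.
have Pl : perm_eq l (flatten (map (@cedges _) cs)).
  apply: uniq_perm => // [|e].
    by apply: (@map_uniq _ _ fst); rewrite -/(unzip1 _) unzip1_flatten_cedges.
  by rewrite -mem_bigcup_cycle_edges -CE inE.
have cover0 : cycle_cover [set:: l] by exists cs.
case: l => [|e l] in Ul CC CE Pl cover0 *.
  have := card_cycle_cover cover0; rewrite (_ : [set:: [::]] = set0) ?cards0.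
    by move=> n0; rewrite -n0 in n_gt1.
  by apply/setP => e; rewrite !inE.
(* [cs'] lists the same cover in the order of visit, and it is this decomposition that gets
   patched. *)
have [cs' [gt1' P1 P2 wE]] := walk_cycles e.1 gt1 U Pl.
have CC' : cycles_of [set:: e :: l] cs'.
  split=> //; first exact: perm_trans P1 P.
  by apply/setP => d; rewrite mem_bigcup_cycle_edges (perm_mem P2) inE.
have U' := uniq_cycles_of CC'.
suff -> : patch_edges (e :: l) = cedges (flatten cs').
  split; last by rewrite -cycle_edgesE; apply: patched_flatten.
  by apply: (@map_uniq _ _ fst); rewrite -/(unzip1 _) unzip1_cedges.
rewrite /patch_edges wE; have : exists p, walk (size (e :: l)) e.1 (e :: l) = e.1 :: p.
  have [|d [r [pE d1]]] := @pull_head _ e.1 (e :: l); first by rewrite /= eqxx.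
  by exists (walk (size l) d.2 r); rewrite [walk _ _ _]/= pE d1.
by rewrite wE => -[p pE]; rewrite pE cedges_cons // -pE.
Qed.

(** * The patching program *)

Section PatchingProgram.

Let v := EVar 0.

(* Accumulators have the form [Node ctx (Node cur l)]; [ctx] is only carried
   along. The test compares pairs because the encoding of vertex 0 is [Leaf],
   which is also the head of an empty list. *)
Definition pull_test : expr :=
  let l := ETl (ETl (ETl v)) in
  EEq (ENode (EHd (EHd l)) (EEq l ELeaf)) (ENode (EHd (ETl (ETl v))) ELeaf).

Definition pull_step (t : tree) : tree :=
  let x := thd t in let ctx := thd (ttl t) in
  let cur := thd (ttl (ttl t)) in let l := ttl (ttl (ttl t)) in
  if truth (eval (fun=> t) pull_test)
  then Node ctx (Node cur (Node (thd l) (Node x (ttl l))))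
  else Node ctx (Node cur (Node x l)).

(** The context holds the start vertex and the visited vertices, latest first. The list folded over
    serves only as a counter, one iteration per edge. *)
Definition walk_step (t : tree) : tree :=
  let u := tfold pull_step (ttl (ttl (ttl t)))
             (Node (thd (ttl t)) (Node (thd (ttl (ttl t))) Leaf)) in
  let ctx := thd u in let l := ttl (ttl u) in
  Node (Node (thd ctx) (Node (thd (thd l)) (ttl ctx)))
    (Node (ttl (thd l)) (ttl l)).

(** The accumulator starts with the vertex processed just before; as vertices come in reverse order,
    it is the successor on the tour. *)
Definition close_step (t : tree) : tree :=
  Node (thd t) (Node (Node (thd t) (thd (ttl t))) (ttl (ttl t))).

Definition patch_tree (t : tree) : tree :=
  let x := thd (thd t) in
  let ctx := thd (tfold walk_step t (Node (Node x Leaf) (Node x t))) in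
  ttl (tfold close_step (ttl ctx) (Node (thd ctx) Leaf)).

Definition patch_all (t : tree) : tree :=
  tfold (fun u => Node (patch_tree (thd u)) (ttl u)) t Leaf.

Lemma truth_enc_bool b : truth (enc_bool b) = b.
Proof. by case: b. Qed.

(** Stated for arbitrary trees, because a polynomial-time bound must hold on inputs that encode
    nothing as well. *)
Lemma tfold_pull_step l ctx cur a :
  exists a', tfold pull_step l (Node ctx (Node cur a)) = Node ctx (Node cur a')
    /\ tsize a' < tsize a + tsize l.
Proof.
elim: l a => [|x _ l IHl] a /=; first by exists a; split=> //; lia.
rewrite {2}/pull_step; case: ifP; rewrite truth_enc_bool /= => test.
  case: a test => [|h t] test.
    by move: test; rewrite /= andbF.
  have [a' [-> lt_a']] := IHl (Node h (Node x t)); exists a'.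
  by split; rewrite //= in lt_a' *; lia.
have [a' [-> lt_a']] := IHl (Node x a); exists a'.
by split; rewrite //= in lt_a' *; lia.
Qed.

Lemma polyfun_pull : polyfun (fun t => tfold pull_step (thd t) (ttl t)).
Proof.
apply: (polyfun_tfold (q := ('X + cst 10)%R)) => [|x a].
  pose x := EHd v; pose ctx := EHd (ETl v); pose cur := EHd (ETl (ETl v)).
  pose l := ETl (ETl (ETl v)).
  exact: (@polyfun_if pull_test _ _ _
    (@polyfun_expr (ENode ctx (ENode cur (ENode (EHd l) (ENode x (ETl l))))) _)
    (@polyfun_expr (ENode ctx (ENode cur (ENode x l))) _)).
have := tsize_thd_ttl a; have := tsize_thd_ttl (ttl a).
have := tsize_thd_ttl (ttl (ttl a)).
by rewrite !pvalE /pull_step; case: ifP => _ /=; lia.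
Qed.

Lemma polyfun_walk : polyfun (fun t => tfold walk_step (thd t) (ttl t)).
Proof.
apply: (polyfun_tfold (q := cst 10)) => [|x a].
  have pre := @polyfun_expr (ENode (ETl (ETl (ETl v)))
    (ENode (EHd (ETl v)) (ENode (EHd (ETl (ETl v))) ELeaf))) isT.
  pose l := ETl (ETl v).
  have post := @polyfun_expr (ENode
    (ENode (EHd (EHd v)) (ENode (EHd (EHd l)) (ETl (EHd v))))
    (ENode (ETl (EHd l)) (ETl l))) isT.
  exact: eq_polyfun (polyfun_comp (polyfun_comp pre polyfun_pull) post).
rewrite pvalE /walk_step [ttl (Node _ _)]/=.
(* Pulling does not enlarge the list, and the step only moves the endpoints of the pulled edge
   elsewhere, so the accumulator grows by a constant. *)
have [a' [-> /=]] := tfold_pull_step (ttl (ttl a)) (thd a) (thd (ttl a)) Leaf.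
have := tsize_thd_ttl a; have := tsize_thd_ttl (ttl a).
have := tsize_thd_ttl a'; have := tsize_thd_ttl (thd a').
by have := tsize_thd_ttl (thd a); rewrite /=; lia.
Qed.

Lemma polyfun_close : polyfun (fun t => tfold close_step (thd t) (ttl t)).
Proof.
apply: (polyfun_tfold (q := (cst 2 * 'X + cst 10)%R)) => [|x a].
  exact: (@polyfun_expr (ENode (EHd v)
    (ENode (ENode (EHd v) (EHd (ETl v))) (ETl (ETl v))))).
by have := tsize_thd_ttl a; rewrite !pvalE /=; lia.
Qed.

Lemma polyfun_patch_tree : polyfun patch_tree.
Proof.
pose x := EHd (EHd v).
have pre := @polyfun_expr (ENode v (ENode (ENode x ELeaf) (ENode x v))) isT.
have mid := @polyfun_expr (ENode (ETl (EHd v)) (ENode (EHd (EHd v)) ELeaf)) isT.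
have post := @polyfun_expr (ETl v) isT.
exact: eq_polyfun (polyfun_comp (polyfun_comp (polyfun_comp (polyfun_comp
  pre polyfun_walk) mid) polyfun_close) post).
Qed.

Lemma polyfun_patch_all : polyfun patch_all.
Proof.
have [c [N [p [_ Hp]]]] := polyfun_patch_tree.
have pre := @polyfun_expr (ENode v ELeaf) isT.
apply: eq_polyfun (polyfun_comp pre (polyfun_tfold (q := (p + cst 1)%R)
  (polyfun_fst polyfun_patch_tree) _)) => // x a.
(* Any run on input [x] yields the bound on the output size. *)
have [t [s [_ _ _ _]]] := Hp xpred0 (fun=> x) 0.
by rewrite !pvalE /=; lia.
Qed.

End PatchingProgram.

(** * Agreement of the program with the traversal on encoded covers *)

Lemma tree_eqb_enc_unary m n :
  tree_eqb (enc_unary m) (enc_unary n) = (m == n).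
Proof. by elim: m n => [|m IHm] [|n] //=; rewrite IHm. Qed.

Section EncodedPatching.

Variable n : nat.
Implicit Types (cur x : 'I_n) (c ord : seq 'I_n) (l acc : seq ('I_n * 'I_n)).

Local Notation enc_vertex := (fun x : 'I_n => enc_unary x).
Local Notation enc_edges := (enc_seq (@enc_edge n)).

Lemma pull_step_enc cur l ctx :
  tfold pull_step (enc_edges l) (Node ctx (Node (enc_vertex cur) Leaf)) =
  Node ctx (Node (enc_vertex cur) (enc_edges (pull cur l))).
Proof.
rewrite /pull -[Leaf]/(enc_edges [::]).
elim: l [::] => //= e l IHl acc; rewrite -IHl; congr (tfold _ _ _).
rewrite /pull_step /pull_ins; case: acc => [|h t] /=.
  by rewrite truth_enc_bool andbF.
by rewrite truth_enc_bool andbT tree_eqb_enc_unary -val_eqE; case: ifP.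
Qed.

(** The counter [s] is independent of [l] except for its length, since after one step the remaining
    edges are no longer the tail of the list folded over. *)
Lemma walk_step_enc (A : Type) (f : A -> tree) (s : seq A) cur l ord ctx :
  size s = size l ->
  thd (tfold walk_step (enc_seq f s)
    (Node (Node ctx (enc_seq enc_vertex ord))
       (Node (enc_vertex cur) (enc_edges l)))) =
  Node ctx (enc_seq enc_vertex (catrev (walk (size l) cur l) ord)).
Proof.
elim: s cur l ord => [|a s IHs] cur l ord sz_l; first by case: l sz_l.
rewrite -[enc_seq f _]/(Node (f a) (enc_seq f s)) [tfold _ _ _]/=.
rewrite {2}/walk_step [ttl (Node _ _)]/= pull_step_enc -sz_l.
have := perm_size (perm_pull cur l); rewrite -sz_l /=.
case: (pull cur l) => // e r [sz_r].
by rewrite -sz_r; apply: (IHs e.2 r (e.1 :: ord)).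
Qed.

(** The fold consumes [rev c], hence the induction from the right; [x] is the target of the last
    edge. *)
Lemma close_step_enc c x l :
  ttl (tfold close_step (enc_seq enc_vertex (rev c))
    (Node (enc_vertex x) (enc_edges l))) =
  enc_edges (zip c (rcons (behead c) x) ++ l).
Proof.
elim/last_ind: c x l => [|c y IHc] x l //=.
rewrite rev_rcons -[tfold _ _ _]/(tfold close_step (enc_seq enc_vertex (rev c))
  (Node (enc_vertex y) (enc_edges ((y, x) :: l)))) IHc.
case: c {IHc} => [//|z c].
rewrite rcons_cons [behead (_ :: rcons _ _)]/= -rcons_cons.
by rewrite zip_rcons ?size_rcons // cat_rcons.
Qed.

Lemma patch_tree_enc l : patch_tree (enc_edges l) = enc_edges (patch_edges l).
Proof.
case: l => // e l; rewrite /patch_tree /patch_edges.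
have /= := @walk_step_enc _ (@enc_edge n) (e :: l) e.1 (e :: l) [::]
  (enc_unary e.1) erefl.
move=> ->.
rewrite catrevE cats0.
by have /= := close_step_enc (walk (size l).+1 e.1 (e :: l)) e.1 [::]; rewrite cats0.
Qed.

Lemma patch_all_enc (ls : seq (seq ('I_n * 'I_n))) :
  patch_all (enc_seq enc_edges ls) =
  enc_seq enc_edges (rev (map (@patch_edges _) ls)).
Proof.
rewrite /patch_all -[Leaf]/(enc_seq enc_edges [::]) -[rev _]cats0 -catrevE.
elim: ls [::] => //= l ls IHls acc.
by rewrite patch_tree_enc (IHls (patch_edges l :: acc)).
Qed.

End EncodedPatching.

Theorem theorem6 (k : nat)
    (fpras : exists F : cmd, cycle_cover_fpras k F) :
  [/\ (exists B : cmd, cycle_cover_pareto12 k B),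
      (exists patch : cmd, forall B : cmd, cycle_cover_pareto12 k B ->
         polytime12 k (Seq B patch) /\ implements_patching k B (Seq B patch))
    & (forall B A : cmd, cycle_cover_pareto12 k B ->
         polytime12 k A -> implements_patching k B A ->
         atsp12_approximation k (3 / 2)%R A)].
Proof.
split; last exact: patching_approximation.
  by have [F /cycle_cover_pareto12_exists] := fpras.
have [c [N [p [_ Hc]]]] := polyfun_patch_all; exists c => B [q Bq].
(* [c] starts in the final store of [B], on a tree no larger than the input plus twice the time of
   [B]. *)
have run x r t y : runs B (enc_inst x) r t y -> exists t',
    runs (Seq B c) (enc_inst x) r (t + t').+1 (patch_all y) /\
    t' <= pval p (tsize (enc_inst x) + 2 * t).
  move=> [s [i [E <-]]]; have [t' [s' [Ec <- _ le_t' _]]] := Hc r s i.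
  exists t'; split; first by exists s', i; split=> //; apply: exec_seq E Ec.
  by apply: leq_trans le_t' _; apply: leq_pval; apply: (tsize_exec E).
split.
  exists (q + (p \Po ('X + cst 2 * q)) + cst 1)%R => x x12 r.
  have [hB _] := Bq x x12; have [t [y [E le_t]]] := hB r.
  have [t' [E' le_t']] := run _ _ _ _ _ E; exists (t + t').+1, (patch_all y).
  split=> //; rewrite !pvalE.
  rewrite addn1 ltnS; apply: leq_add => //; apply: leq_trans le_t' _.
  by apply: leq_pval; rewrite leq_add2l leq_mul2l.
move=> x r t y P x12 /run[t' [E _]] [ls [yE Uls PE]] PC.
exists (t + t').+1, (patch_all y).
pose ls' := rev (map (@patch_edges _) ls).
exists [set S in [seq [set:: l] | l <- ls']].
have good l : l \in ls ->
    uniq (patch_edges l) /\ patched [set:: l] [set:: patch_edges l].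
  move=> l_ls; apply: patch_edges_patched; first exact: nv_gt1.
    exact: (allP Uls).
  by apply: PC; rewrite PE inE; apply: map_f.
split=> //.
  exists ls'; split=> //; first by rewrite yE patch_all_enc.
  by rewrite all_rev all_map; apply/allP => l /good[].
split=> [C|S].
  rewrite PE inE => /mapP[l l_ls ->]; exists [set:: patch_edges l].
    by rewrite inE map_f // mem_rev map_f.
  by case: (good l).
rewrite inE => /mapP[_ /[!mem_rev] /mapP[l l_ls ->] ->].
exists [set:: l]; last by case: (good l).
by rewrite PE inE map_f.
Qed.
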